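(* Let $n>1$ be an integer and let $r,s\in\mathbb{N}$. Then (a) $$L_{r,s}(n) = M_{r,s}(n) = \sum_{m=1}^{n-1} \sigma_r (m)\, \sigma_s (n-m);$$ (b) $$L'_{r,s}(n) = M'_{r,s}(n) = \sum_{m=1}^{n-1} \sigma'_{r,s} (m,n-m).$$
   Context: $\mathbb{N}$ denotes the set of positive integers and $\mathbb{N}_0=\mathbb{N}\cup\{0\}$. $\sigma_k(n)$ is the sum of the $k$th powers of the positive divisors of $n$. For $m,n\in\mathbb{N}$ and $r,s\in\mathbb{N}_0$, $$\sigma'_{r,s}(m,n)=\sum_{\substack{(d,e)\in\mathbb{N}^2\\ d\mid m,\ e\mid n\\ \gcd(d,e)=\gcd(m/d,\,n/e)=1}} d^r e^s.$$ For an integer $n\ge 2$ let $$\mathcal{B}(n)=\{(a,b,x,y)\in\mathbb{N}^4 : ax+by=n\},\qquad \mathcal{B}'(n)=\{(a,b,x,y)\in\mathbb{N}^4 : ax+by=n,\ \gcd(a,b)=\gcd(x,y)=1\}.$$ For an integer $n>1$ and $r,s\in\mathbb{N}$ define (where membership of a tuple containing radicals in $\mathcal{B}(n)$ or $\mathcal{B}'(n)$ includes the requirement that these radicals be positive integers) $$L_{r,s}(n) = \# \{ (a,b,c,d,x,y)\in \mathbb{N}_{0}^2 \times \mathbb{N}^4 : ( \sqrt[r]{a+c}, \sqrt[s]{b+d}, x, y) \in \mathcal{B}(n) \},$$ $$M_{r,s}(n) = \# \{ (a,b,c,d,x,y,k,l)\in \mathbb{N}_0^{2}\times\mathbb{N}^6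 : ( \sqrt[r]{k(a+c)}, \sqrt[s]{l(b+d)},x,y)\in \mathcal{B}(n) \text{ and } \gcd(a,c)=\gcd(b,d)=1 \},$$ $$L'_{r,s}(n) = \# \{ (a,b,c,d,x,y)\in \mathbb{N}_{0}^2 \times \mathbb{N}^4 : ( \sqrt[r]{a+c}, \sqrt[s]{b+d}, x, y) \in \mathcal{B}'(n) \},$$ $$M'_{r,s}(n) = \# \{ (a,b,c,d,x,y,k,l)\in \mathbb{N}_0^{2}\times\mathbb{N}^6 : ( \sqrt[r]{k(a+c)}, \sqrt[s]{l(b+d)},x,y)\in \mathcal{B}'(n) \text{ and } \gcd(a,c)=\gcd(b,d)=1 \}.$$ Here $\gcd(0,c)=c$. *)

(* Defs.v *)
From mathcomp Require Import all_boot.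
From mathcomp Require Import boolp classical_sets functions cardinality.

Set Implicit Arguments.
Unset Strict Implicit.
Unset Printing Implicit Defensive.

Local Open Scope classical_set_scope.
Local Open Scope nat_scope.

Definition sigma (k n : nat) : nat := \sum_(d <- divisors n) d ^ k.

Definition sigma' (r s m n : nat) : nat :=
  \sum_(d <- divisors m)
    \sum_(e <- divisors n | coprime d e && coprime (m %/ d) (n %/ e))
      d ^ r * e ^ s.

Definition B (n : nat) : set (nat * nat * nat * nat) :=
  [set t | let: (a, b, x, y) := t in
    [&& 0 < a, 0 < b, 0 < x & 0 < y] /\ a * x + b * y = n].

Definition B' (n : nat) : set (nat * nat * nat * nat) :=
  [set t | let: (a, b, x, y) := t in
    [/\ B n (a, b, x, y), gcdn a b = 1 & gcdn x y = 1]].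

(* [is_root r m u]: the [r]-th root of [m] is the natural number [u]
   (meaningful for [0 < r], where [u] is unique). *)
Definition is_root (r m u : nat) : Prop := u ^ r = m.

(* [root_mem r s p q x y A]: the tuple (p^(1/r), q^(1/s), x, y) lies in [A];
   in particular both radicals are natural numbers, and positive ones when [A]
   is [B n] or [B' n]. *)
Definition root_mem (r s p q x y : nat) (A : set (nat * nat * nat * nat)) :
    Prop :=
  exists u v, [/\ is_root r p u, is_root s q v & A (u, v, x, y)].

(* Every component is a positive integer except [a] and [b], which may be
   zero; [gcdn 0 c = c]. *)
Definition Lset_of (A : set (nat * nat * nat * nat)) (r s : nat) :
    set (nat * nat * nat * nat * nat * nat) :=
  [set t | let: (a, b, c, d, x, y) := t in
    [&& 0 < c, 0 < d, 0 < x & 0 < y] /\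
    root_mem r s (a + c) (b + d) x y A].

Definition Mset_of (A : set (nat * nat * nat * nat)) (r s : nat) :
    set (nat * nat * nat * nat * nat * nat * nat * nat) :=
  [set t | let: (a, b, c, d, x, y, k, l) := t in
    [/\ [&& 0 < c, 0 < d, 0 < x, 0 < y, 0 < k & 0 < l],
        root_mem r s (k * (a + c)) (l * (b + d)) x y A,
        gcdn a c = 1 & gcdn b d = 1]].

Definition Lset (r s n : nat) := Lset_of (B n) r s.
Definition Mset (r s n : nat) := Mset_of (B n) r s.
Definition Lset' (r s n : nat) := Lset_of (B' n) r s.
Definition Mset' (r s n : nat) := Mset_of (B' n) r s.

(* Main.v *)
Require Import Defs.
From mathcomp Require Import all_boot.
From mathcomp Require Import boolp classical_sets functions cardinality.

Local Open Scope classical_set_scope.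
Local Open Scope card_scope.
Local Open Scope nat_scope.

(** Both parts are instances of one count, in which the set of admissible
    quadruples is cut out of [B n] by a boolean predicate [P]: constantly
    true for [B n] itself, the two coprimality conditions for [B' n].

    The sets [L] and [M] are in bijection, whatever the set of quadruples
    ([card_Lset_Mset]): a pair [(a, c)] with [0 < c] is written uniquely as
    [(k * a', k * c')] with [0 < k] and [gcdn a' c' = 1], namely with
    [k = gcdn a c], and [k * (a' + c') = a + c].

    To count [L] ([card_Lset_of]), map it to the quadruples [(u, v, x, y)]
    with [u ^ r = a + c] and [v ^ s = b + d]. The fibre over [(u, v, x, y)]
    consists of the choices of [a < u ^ r] and [b < v ^ s], so it has
    [u ^ r * v ^ s] elements. The quadruples are sorted by the value
    [m = u * x], which runs from [1] to [n - 1]; for a given [m], they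
    correspond to a divisor [u] of [m] and a divisor [v] of [n - m], with
    cofactors [x] and [y]. Summing the sizes of the fibres gives the divisor
    sums. *)

Lemma card_eq_seq {T : eqType} (A : set T) (s : seq T) :
  uniq s -> (forall t, A t <-> t \in s) -> A #= `I_(size s).
Proof.
move=> Us As; apply/card_set_bijP; exists (index^~ s); split.
- by move=> t /As ts /=; rewrite index_mem.
- move=> t t'; rewrite !inE => /As ts /As ts' eq_i.
  by rewrite -(nth_index t ts) eq_i nth_index.
- move=> i /= lt_i; case: s Us As lt_i => // t0 s Us As lt_i.
  exists (nth t0 (t0 :: s) i); first by apply/As; rewrite mem_nth.
  exact: index_uniq.
Qed.

(** The concatenation of pairwise disjoint lists without repetitions has no
    repetition. *)
Lemma uniq_flatten_map {S R : eqType} (s : seq S) (f : S -> seq R) :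
    uniq s -> (forall x, uniq (f x)) ->
    (forall x y w, w \in f x -> w \in f y -> x = y) ->
  uniq (flatten [seq f x | x <- s]).
Proof.
move=> Us Uf f_inj; elim: s Us => //= x s IHs /andP[s'x Us].
rewrite cat_uniq Uf IHs // andbT; apply: contra s'x => /hasP[w].
by case/flatten_mapP=> y sy wy wx; rewrite (f_inj _ _ _ wx wy).
Qed.

Lemma gcd_factorization (p q : nat) : 0 < q ->
  [/\ 0 < gcdn p q, 0 < q %/ gcdn p q,
      gcdn (p %/ gcdn p q) (q %/ gcdn p q) = 1,
      gcdn p q * (p %/ gcdn p q) = p & gcdn p q * (q %/ gcdn p q) = q].
Proof.
move=> q_gt0; have g_gt0 : 0 < gcdn p q by rewrite gcdn_gt0 q_gt0 orbT.
have Ep : gcdn p q * (p %/ gcdn p q) = p by rewrite mulnC divnK ?dvdn_gcdl.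
have Eq : gcdn p q * (q %/ gcdn p q) = q by rewrite mulnC divnK ?dvdn_gcdr.
split=> //; first by rewrite divn_gt0 // dvdn_leq ?dvdn_gcdr.
by apply/eqP; rewrite -(eqn_pmul2l g_gt0) muln_gcdr Ep Eq muln1.
Qed.

(** The bijection goes from [M] to [L]: it multiplies [(a, c)] by [k] and
    [(b, d)] by [l]. *)
Lemma card_Lset_Mset (A : set (nat * nat * nat * nat)) (r s : nat) :
  Lset_of A r s #= Mset_of A r s.
Proof.
rewrite card_eq_sym; apply/card_set_bijP.
exists (fun '(a, b, c, d, x, y, k, l) =>
          (k * a, l * b, k * c, l * d, x, y)); split.
- case=> [[[[[[[a b] c] d] x] y] k] l] [].
  move=> /and5P[c0 d0 x0 y0 /andP[k0 l0]] rt _ _.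
  by split; [rewrite !muln_gt0 c0 d0 x0 y0 k0 l0 | rewrite -!mulnDr].
- case=> [[[[[[[a b] c] d] x] y] k] l] [[[[[[[a' b'] c'] d'] x'] y'] k'] l'].
  rewrite !inE => -[] /and5P[_ _ _ _ /andP[k0 l0]] _ gac gbd.
  move=> [] /and5P[_ _ _ _ /andP[k0' l0']] _ gac' gbd' [Ea Eb Ec Ed <- <-].
  (* As [(a, c)] is coprime, [k] is the gcd of the image [(k * a, k * c)]. *)
  have Ek : k = k'.
    by rewrite -[k]muln1 -gac muln_gcdr Ea Ec -muln_gcdr gac' muln1.
  have El : l = l'.
    by rewrite -[l]muln1 -gbd muln_gcdr Eb Ed -muln_gcdr gbd' muln1.
  subst k' l'; move/eqP: Ea; move/eqP: Eb; move/eqP: Ec; move/eqP: Ed.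
  by rewrite !eqn_pmul2l // => /eqP-> /eqP-> /eqP-> /eqP->.
- case=> [[[[[a b] c] d] x] y] [/and4P[c0 d0 x0 y0] rt].
  have [g0 c'0 ac1 Ea Ec] := gcd_factorization a c c0.
  have [h0 d'0 bd1 Eb Ed] := gcd_factorization b d d0.
  exists (a %/ gcdn a c, b %/ gcdn b d, c %/ gcdn a c, d %/ gcdn b d, x, y,
          gcdn a c, gcdn b d); last by rewrite Ea Eb Ec Ed.
  split=> //; first by rewrite c'0 d'0 x0 y0 g0 h0.
  by rewrite !mulnDr Ea Eb Ec Ed.
Qed.

(** The list of the [(a, b, x, y)] in [B n] that satisfy [P]: for each value
    [m] of [a * x], the entries [a] and [b] run through the divisors of [m]
    and [n - m], and [x] and [y] are the complementary divisors. *)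
Definition solutions (P : nat -> nat -> nat -> nat -> bool) (n : nat) :
    seq (nat * nat * nat * nat) :=
  flatten [seq [seq (d, e, m %/ d, (n - m) %/ e)
                  | d <- divisors m,
                    e <- [seq e <- divisors (n - m)
                           | P d e (m %/ d) ((n - m) %/ e)]]
             | m <- index_iota 1 n].

Lemma mem_solutions P n a b x y :
  ((a, b, x, y) \in solutions P n) <->
  B n (a, b, x, y) /\ P a b x y.
Proof.
split.
  case/flatten_mapP=> m; rewrite mem_index_iota => /andP[m0 mn].
  have nm0 : 0 < n - m by rewrite subn_gt0.
  case/allpairsPdep=> d [e []]; rewrite mem_filter -!dvdn_divisors //.
  move=> dm /andP[Pde en] [-> -> -> ->]; split; last exact: Pde.
  split.
    have [d0 e0] := (dvdn_gt0 m0 dm, dvdn_gt0 nm0 en).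
    by rewrite !divn_gt0 // d0 e0 (dvdn_leq m0 dm) (dvdn_leq nm0 en).
  by rewrite ![_ * (_ %/ _)]mulnC !divnK // subnKC // ltnW.
case=> -[/and4P[a0 b0 x0 y0] En] Pab.
have ax0 : 0 < a * x by rewrite muln_gt0 a0.
have by0 : 0 < b * y by rewrite muln_gt0 b0.
have Eby : n - a * x = b * y by rewrite -En addKn.
apply/flatten_mapP; exists (a * x).
  by rewrite mem_index_iota ax0 -subn_gt0 Eby by0.
rewrite Eby; apply/allpairsPdep; exists a, b.
by rewrite mem_filter -!dvdn_divisors // !dvdn_mulr // !mulKn // Pab.
Qed.

Lemma solutions_uniq P n : uniq (solutions P n).
Proof.
apply: uniq_flatten_map (iota_uniq _ _) _ _.
  move=> m; apply: allpairs_uniq_dep; first exact: divisors_uniq.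
    by move=> d _; apply/filter_uniq/divisors_uniq.
  by move=> [d e] [d' e'] _ _ /= [-> ->].
(* The index is recovered from a solution as [a * x]; for [k = 0] this holds
   since the quotient is then [0]. *)
have mE k a b x y : (a, b, x, y) \in [seq (d, e, k %/ d, (n - k) %/ e)
    | d <- divisors k, e <- [seq e <- divisors (n - k)
                           | P d e (k %/ d) ((n - k) %/ e)]] -> a * x = k.
  case/allpairsPdep=> d [e [dk _ [-> _ -> _]]].
  case: k dk => [|k] dk; first by rewrite div0n muln0.
  by rewrite mulnC divnK // dvdn_divisors.
by move=> m m' [[[a b] x] y] /mE <- /mE.
Qed.

(** The list of the [(a, b, c, d, x, y)] lying over [(u, v, x, y)], that is,
    with [a + c = u ^ r], [b + d = v ^ s] and [c], [d] positive. *)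
Definition lifts (r s : nat) (t : nat * nat * nat * nat) :
    seq (nat * nat * nat * nat * nat * nat) :=
  let: (u, v, x, y) := t in
  [seq (i, j, u ^ r - i, v ^ s - j, x, y)
     | i <- iota 0 (u ^ r), j <- iota 0 (v ^ s)].

Lemma mem_lifts r s u v x y a b c d x' y' :
  (a, b, c, d, x', y') \in lifts r s (u, v, x, y) <->
  [/\ [&& 0 < c & 0 < d], a + c = u ^ r, b + d = v ^ s, x' = x & y' = y].
Proof.
split.
  case/allpairsP=> -[i j] /= []; rewrite !mem_iota !add0n /=.
  move=> iu jv [-> -> -> -> -> ->].
  by rewrite !subn_gt0 iu jv !subnKC // ltnW.
case=> /andP[c0 d0] Eu Ev -> ->; apply/allpairsP; exists (a, b) => /=.
by rewrite -Eu -Ev !mem_iota !add0n !addKn -!ltn_subLR ?subnn ?c0 ?d0.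
Qed.

Lemma lifts_uniq r s t : uniq (lifts r s t).
Proof.
case: t => [[[u v] x] y]; apply: allpairs_uniq; rewrite ?iota_uniq //.
by move=> [i j] [i' j'] _ _ /= [-> ->].
Qed.

Lemma size_lifts r s u v x y : size (lifts r s (u, v, x, y)) = u ^ r * v ^ s.
Proof. by rewrite size_allpairs !size_iota. Qed.

(** The distinct quadruples have disjoint fibres because [u] is determined by
    [u ^ r] when [0 < r], and [v] by [v ^ s] when [0 < s]. *)
Lemma card_Lset_of (A : set (nat * nat * nat * nat))
    (P : nat -> nat -> nat -> nat -> bool) (n r s : nat) :
    0 < r -> 0 < s ->
    (forall a b x y, A (a, b, x, y) <-> B n (a, b, x, y) /\ P a b x y) ->
  Lset_of A r s #=
  `I_(\sum_(1 <= m < n) \sum_(d <- divisors m)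
        \sum_(e <- divisors (n - m) | P d e (m %/ d) ((n - m) %/ e))
          d ^ r * e ^ s).
Proof.
move=> r0 s0 AP.
pose ts := flatten [seq lifts r s t | t <- solutions P n].
suff -> : (\sum_(1 <= m < n) \sum_(d <- divisors m)
        \sum_(e <- divisors (n - m) | P d e (m %/ d) ((n - m) %/ e))
          d ^ r * e ^ s) = size ts.
  apply: card_eq_seq => [|[[[[[a b] c] d] x] y]].
    apply: uniq_flatten_map (solutions_uniq _ _) (lifts_uniq _ _) _.
    move=> [[[u v] x] y] [[[u' v'] x'] y'] [[[[[a b] c] d] p] q].
    move=> /mem_lifts[_ Eu Ev -> ->] /mem_lifts[_ Eu' Ev' -> ->].
    rewrite Eu in Eu'; rewrite Ev in Ev'.
    by rewrite (expIn r0 Eu') (expIn s0 Ev').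
  split=> [[/and4P[c0 d0 _ _] [u [v [ru sv /AP Aw]]]]|].
    apply/flatten_mapP; exists (u, v, x, y); first exact/mem_solutions.
    by apply/mem_lifts; rewrite c0 d0 ru sv.
  case/flatten_mapP=> -[[[u v] x'] y'] /mem_solutions Aw.
  case/mem_lifts=> /andP[c0 d0] Eu Ev -> ->; split.
    by case: Aw => -[/and4P[_ _ -> ->]]; rewrite c0 d0.
  by exists u, v; split=> //; apply/AP.
rewrite size_flatten /shape -map_comp sumnE big_map big_flatten big_map.
apply: eq_bigr => m _; rewrite big_allpairs_dep.
apply: eq_bigr => d _; rewrite big_filter.
by apply: eq_bigr => e _; rewrite /= size_lifts.
Qed.

Theorem theorem7 (n r s : nat) (hn : 1 < n) (hr : 0 < r) (hs : 0 < s) :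
  (Lset r s n #= Mset r s n /\
   Mset r s n #= `I_(\sum_(1 <= m < n) sigma r m * sigma s (n - m)))
  /\
  (Lset' r s n #= Mset' r s n /\
   Mset' r s n #= `I_(\sum_(1 <= m < n) sigma' r s m (n - m))).
Proof.
have LM A : Lset_of A r s #= Mset_of A r s := card_Lset_Mset A r s.
split; (split; first exact: LM).
- have -> : \sum_(1 <= m < n) sigma r m * sigma s (n - m) =
      \sum_(1 <= m < n) \sum_(d <- divisors m)
        \sum_(e <- divisors (n - m) | true) d ^ r * e ^ s.
    apply: eq_bigr => m _; rewrite /sigma big_distrl.
    by apply: eq_bigr => d _; rewrite big_distrr.
  have ML := LM (B n); rewrite card_eq_sym in ML; apply: card_eq_trans ML _.
  apply: (card_Lset_of _ (fun _ _ _ _ => true)) => // a b x y.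
  by split=> [|[]].
- have ML := LM (B' n); rewrite card_eq_sym in ML; apply: card_eq_trans ML _.
  apply: (card_Lset_of _ (fun a b x y => coprime a b && coprime x y)) => //.
  move=> a b x y; split=> [[Bn ab xy]|[Bn /andP[/eqP ab /eqP xy]]] //.
  by split=> //; rewrite /coprime ab xy.
Qed.
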